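(* Let $\gamma$ be a non-zero ordinal and let $m\in\omega\setminus\{0\}$. Then (1) $\omega^\gamma\cdot m+1$ is order-reinforcing; and (2) $\omega^\gamma$ is order-reinforcing.
   Context: Ordinals carry the order topology; a set of ordinals carries the subspace topology induced from any ordinal containing it. Two sets of ordinals $X,Y$ are order-homeomorphic if there is an order-preserving homeomorphism from $X$ to $Y$. An ordinal $\alpha$ is order-reinforcing if whenever $X$ is a set of ordinals homeomorphic to $\alpha$, there is a subset $Y\subseteq X$ that is order-homeomorphic to $\alpha$. *)

(* Defs.v *)
From HB Require Import structures.
From mathcomp Require Import all_boot all_order generic_quotient interval.
From mathcomp Require Import all_classical topology.

Set Implicit Arguments.
Unset Strict Implicit.
Unset Printing Implicit Defensive.

Import Order.TTheory.

Local Open Scope classical_set_scope.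
Local Open Scope order_scope.
Local Open Scope quotient_scope.

(* Ordinals are built as well-founded trees modulo equality of rank, where    *)
(* [tnode f] has rank the least ordinal greater than all the ranks of the     *)
(* [f x]. With [A] ranging over a universe this is the class of the ordinals  *)
(* that are small in this universe; [ord_wf], [lsub_leP], [ord_seg_small] and *)
(* [ord_of_well_order] below justify the encoding.                            *)
Inductive ordtree : Type := tnode (A : Type) (f : A -> ordtree).

Fixpoint tle (s : ordtree) : ordtree -> Prop :=
  match s with
  | tnode A f => fun t =>
      forall x : A, match t with tnode B g => exists y : B, tle (f x) (g y) end
  end.

Definition tlt (s t : ordtree) : Prop :=
  match t with tnode B g => exists y : B, tle s (g y) end.

Lemma tleE A (f : A -> ordtree) t :
  tle (tnode f) t <-> forall x, tlt (f x) t.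
Proof. by case: t. Qed.

Lemma tle_refl s : tle s s.
Proof. by elim: s => A f IH /= x; exists x. Qed.

Lemma tle_trans s t u : tle s t -> tle t u -> tle s u.
Proof.
elim: s t u => A f IH [B g] [C h] /= st tu x.
by have [y xy] := st x; have [z yz] := tu y; exists z; exact: IH yz.
Qed.

Lemma tlt_le_trans s t u : tlt s t -> tle t u -> tlt s u.
Proof.
case: t u => B g [C h] /= [y sy] /(_ y)[z yz].
by exists z; exact: tle_trans yz.
Qed.

Lemma tle_lt_trans s t u : tle s t -> tlt t u -> tlt s u.
Proof. by case: u => C h st [z tz]; exists z; exact: tle_trans tz. Qed.

Lemma tlt_irr s : ~ tlt s s.
Proof.
by elim: s => A f IH [x xf]; exact: (IH x (iffLR (tleE _ _) xf x)).
Qed.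

Lemma tltNge s t : tlt s t <-> ~ tle t s.
Proof.
split=> [st ts|]; first exact: (@tlt_irr s (tlt_le_trans st ts)).
elim: s t => A f IH [B g] /= /existsNP[y sy]; exists y; apply/tleE => x.
have [//|nfg] := pselect (tlt (f x) (g y)).
exfalso; apply: sy; exists x; apply: contrapT => nlt.
by apply: nfg; exact: IH.
Qed.

Lemma tlt_le s t : tlt s t -> tle s t.
Proof.
elim: s t => A f IH [B g] [y sy] x; exists y.
exact/IH/(iffLR (tleE _ _) sy).
Qed.

Lemma tle_total s t : tle s t \/ tle t s.
Proof.
by have [?|/tltNge/tlt_le] := pselect (tle s t); [left|right].
Qed.

Lemma tlt_wf : well_founded tlt.
Proof.
move=> s; suff : forall t, tle t s -> Acc tlt t by apply; exact: tle_refl.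
elim: s => A f IH t ts; constructor=> u ut.
by have [x ux] := tlt_le_trans ut ts; exact: IH ux.
Qed.

HB.instance Definition _ := gen_eqMixin ordtree.
HB.instance Definition _ := gen_choiceMixin ordtree.

Definition teq (s t : ordtree) : bool := `[< tle s t /\ tle t s >].

Lemma teq_refl : reflexive teq.
Proof. by move=> s; apply/asboolP; split; exact: tle_refl. Qed.

Lemma teq_sym : symmetric teq.
Proof. by move=> s t; apply/asboolP/asboolP => -[]. Qed.

Lemma teq_trans : transitive teq.
Proof.
move=> t s u /asboolP[st ts] /asboolP[tu ut]; apply/asboolP.
by split; [exact: tle_trans tu|exact: tle_trans ts].
Qed.

Canonical teq_equiv := EquivRel teq teq_refl teq_sym teq_trans.

Definition Ord : Type := {eq_quot teq}.

HB.instance Definition _ := EqQuotient.on Ord.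
HB.instance Definition _ := Choice.on Ord.

Definition ord_le (a b : Ord) : bool := `[< tle (repr a) (repr b) >].

Lemma repr_piK (s : ordtree) :
  tle (repr (\pi_Ord s)) s /\ tle s (repr (\pi_Ord s)).
Proof.
have : \pi_Ord (repr (\pi_Ord s)) = \pi_Ord s by rewrite reprK.
by move=> /eqmodP/asboolP.
Qed.

Lemma ord_le_refl : reflexive ord_le.
Proof. by move=> a; apply/asboolP; exact: tle_refl. Qed.

Lemma ord_le_anti : antisymmetric ord_le.
Proof.
move=> a b /andP[/asboolP ab /asboolP ba].
by rewrite -[a]reprK -[b]reprK; apply/eqmodP/asboolP.
Qed.

Lemma ord_le_trans : transitive ord_le.
Proof.
by move=> b a c /asboolP ab /asboolP bc; apply/asboolP; exact: tle_trans bc.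
Qed.

Lemma ord_le_total : total ord_le.
Proof.
move=> a b; apply/orP.
by case: (tle_total (repr a) (repr b)) => /asboolP; [left|right].
Qed.

Fact ord_display : Order.disp_t. Proof. exact: Order.Disp tt tt. Qed.

HB.instance Definition _ := Order.Le_isPOrder.Build ord_display Ord
  ord_le_refl ord_le_anti ord_le_trans.
HB.instance Definition _ :=
  Order.POrder_isTotal.Build ord_display Ord ord_le_total.
HB.instance Definition _ := OrderTopological.copy Ord (order_topology Ord).

Lemma ord_leP (a b : Ord) : reflect (tle (repr a) (repr b)) (a <= b).
Proof. exact: asboolP. Qed.

Lemma ord_ltP (a b : Ord) : reflect (tlt (repr a) (repr b)) (a < b).
Proof.
rewrite ltNge; apply: (iffP idP) => [/ord_leP/tltNge //|].
by move=> /tltNge nba; apply/ord_leP.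
Qed.

Lemma ord_wf : well_founded (fun a b : Ord => a < b).
Proof.
suff H t : Acc tlt t -> forall a : Ord, repr a = t -> Acc (fun a b => a < b) a.
  by move=> a; exact: H (tlt_wf _) _ erefl.
elim=> {}t _ IH a ta; constructor=> b /ord_ltP; rewrite ta => bt.
exact: IH bt _ erefl.
Qed.

Definition lsub (A : Type) (f : A -> Ord) : Ord :=
  \pi_Ord (tnode (fun x => repr (f x))).

Lemma lsub_leP A (f : A -> Ord) (b : Ord) :
  (lsub f <= b) <-> (forall x, f x < b).
Proof.
have [le_r ge_r] := repr_piK (tnode (fun x => repr (f x))).
split=> [/ord_leP fb x|fb].
  by apply/ord_ltP; exact: (iffLR (tleE _ _) (tle_trans ge_r fb)).
apply/ord_leP; apply: (tle_trans le_r); apply/tleE => x.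
exact/ord_ltP/fb.
Qed.

Lemma lt_lsub A (f : A -> Ord) x : f x < lsub f.
Proof. by move: x; apply/lsub_leP. Qed.

Definition seg (a : Ord) : set Ord := [set b | b < a].

Lemma ord_seg_small (a : Ord) : exists (A : Type) (f : A -> Ord),
  seg a = range f.
Proof.
suff [A [f fP]] : exists (A : Type) (f : A -> Ord), seg a `<=` range f.
  exists {x : A | f x < a}, (fun x => f (proj1_sig x)).
  apply/seteqP; split=> [b ba|b [[x fxa] _ <-] //].
  by have [x _ fxb] := fP b ba; exists (exist _ x (eq_ind_r (fun c => c < a) ba fxb)).
elim/(well_founded_ind ord_wf): a => a IH.
have : exists t, \pi_Ord t = a by exists (repr a); rewrite reprK.
case=> -[B g] ga; pose h y : Ord := \pi_Ord (g y).
have ha y : h y < a.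
  apply/ord_ltP; rewrite /h -ga.
  apply: tle_lt_trans (proj1 (repr_piK _)) _.
  apply: tlt_le_trans (proj2 (repr_piK _)); exists y; exact: tle_refl.
pose IHy y := cid (IH _ (ha y)).
pose A y := projT1 (IHy y); pose F y := cid (projT2 (IHy y)).
exists (B + {y : B & A y})%type, (fun z => match z with
  | inl y => h y | inr yx => projT1 (F (projT1 yx)) (projT2 yx) end).
move=> b /ord_ltP ba.
have [y by_] : tlt (repr b) (tnode g).
  by apply: tlt_le_trans ba _; rewrite -ga; exact: (proj1 (repr_piK _)).
have : b <= h y.
  by apply/ord_leP; apply: tle_trans by_ (proj2 (repr_piK _)).
rewrite le_eqVlt => /predU1P[->|bh]; first by exists (inl y).
have [x _ xb] := projT2 (F y) b bh.
by exists (inr (existT _ y x)).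
Qed.

Lemma ord_of_well_order (A : Type) (R : A -> A -> Prop) :
    well_founded R -> (forall x y z, R x y -> R y z -> R x z) ->
    (forall x y, R x y \/ x = y \/ R y x) ->
  exists (a : Ord) (f : A -> Ord), range f = seg a /\
    (forall x y, R x y <-> f x < f y).
Proof.
move=> wfR trR totR.
pose f := Fix wfR (fun _ => Ord)
  (fun x r => lsub (fun y : {y | R y x} => r _ (proj2_sig y))).
have fE x : f x = lsub (fun y : {y | R y x} => f (proj1_sig y)).
  rewrite /f Fix_eq //= => {}x r r' rr'.
  by congr lsub; apply/funext => -[y yx] /=.
have fR x y : R x y -> f x < f y.
  by move=> xy; rewrite (fE y); exact: (lt_lsub _ (exist _ x xy)).
have Rf x y : f x < f y -> R x y.
  move=> xy; have [//|[E|/fR yx]] := totR x y.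
    by rewrite E ltxx in xy.
  by have := lt_trans xy yx; rewrite ltxx.
exists (lsub f), f; split; last by move=> x y; split; [exact: fR|exact: Rf].
apply/seteqP; split=> [_ [x _ <-]|b]; first exact: lt_lsub.
elim/(well_founded_ind ord_wf): b => b IH /= blt.
have /existsNP[x /negP] : ~ forall x, f x < b.
  by move=> /lsub_leP; rewrite leNgt blt.
rewrite -leNgt => bx.
elim/(well_founded_ind wfR): x bx => x IHx.
rewrite le_eqVlt => /predU1P[->|]; first by exists x.
have [//|nb] := pselect (forall y, R y x -> f y < b).
  by move=> h; rewrite fE ltNge => /negP[]; apply/lsub_leP => -[y yx]; exact: h.
move=> _; move: nb => /existsNP[y /not_implyP[yx /negP]].
by rewrite -leNgt; exact: IHx.
Qed.

Lemma ord_minP (P : set Ord) :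
  P !=set0 -> exists2 a, P a & forall b, P b -> a <= b.
Proof.
move=> [a]; elim/(well_founded_ind ord_wf): a => a IH Pa.
have [h|/existsNP[b /not_implyP[Pb /negP]]] :=
  pselect (forall b, P b -> a <= b); first by exists a.
by rewrite -ltNge => /IH; exact.
Qed.

Definition ord_zero : Ord := lsub (of_void Ord).

Definition ord_succ (a : Ord) : Ord := lsub (fun _ : unit => a).

Definition ord_sup (X : set Ord) : Ord := supremum ord_zero X.

Lemma ord_ge0 (a : Ord) : ord_zero <= a.
Proof. by apply/lsub_leP => -[]. Qed.

Lemma ord_succ_le (a b : Ord) : (ord_succ a <= b) = (a < b).
Proof.
by apply/idP/idP => [/lsub_leP/(_ tt)//|ab]; apply/lsub_leP.
Qed.

Lemma ord_lt_succ (a b : Ord) : (a < ord_succ b) = (a <= b).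
Proof. by rewrite ltNge ord_succ_le -leNgt. Qed.

Lemma ord_succ_inj : injective ord_succ.
Proof.
move=> a b E; apply/le_anti.
by rewrite -!ord_lt_succ E !ord_lt_succ lexx -ord_lt_succ -E ord_lt_succ lexx.
Qed.

Lemma ord_supP A (f : A -> Ord) (b : Ord) :
  (ord_sup (range f) <= b) <-> (forall x, f x <= b).
Proof.
have [[x0 _]|A0] := pselect (exists x : A, True); last first.
  have -> : range f = set0 by rewrite -subset0 => y [x]; case: A0; exists x.
  rewrite /ord_sup /supremum eqxx.
  by split=> [_ x|_]; [case: A0; exists x|exact: ord_ge0].
have ub0 : ubound (range f) !=set0.
  by exists (lsub f) => _ [x _ <-]; exact/ltW/lt_lsub.
have : supremums (range f) !=set0.
  by have [a ua la] := ord_minP ub0; exists a; split.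
move=> /(xgetPex ord_zero)[ub lb]; have -> : ord_sup (range f) =
    xget ord_zero (supremums (range f)).
  rewrite /ord_sup /supremum ifN //.
  by apply/set0P; exists (f x0), x0.
split=> [fb x|fb]; first by apply: le_trans fb; apply: ub; exists x.
by apply: lb => _ [x _ <-].
Qed.

Lemma ord_sup_segP (F : Ord -> Ord) (a b : Ord) :
  (ord_sup (F @` seg a) <= b) <-> (forall c, c < a -> F c <= b).
Proof.
have [A [f fa]] := ord_seg_small a.
have faP c : c < a <-> range f c by rewrite -fa.
rewrite fa image_comp; split=> [h c /faP[x _ <-]|h].
  exact: (iffLR (ord_supP _ _) h).
by apply/ord_supP => x; apply/h/faP; exists x.
Qed.

Definition ord_limit (a : Ord) : Prop :=
  a <> ord_zero /\ forall b, b < a -> ord_succ b < a.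

(* Transfinite iteration:                                                     *)
(*   ord_iter z s 0 = z, ord_iter z s (a + 1) = s (ord_iter z s a), and       *)
(*   ord_iter z s a = sup_(b < a) ord_iter z s b for limit a                  *)
(* (lemmas [ord_iter0], [ord_iterS] and [ord_iter_lim]).                      *)
Definition ord_iter (z : Ord) (s : Ord -> Ord) : Ord -> Ord :=
  Fix ord_wf (fun _ => Ord) (fun a r =>
    if a == ord_zero then z else
    match pselect (exists2 b, b < a & a = ord_succ b) with
    | left h => let: exist2 b ba _ := cid2 h in s (r b ba)
    | right _ => ord_sup [set r (val b) (valP b) | b in [set: {b : Ord | b < a}]]
    end).

Lemma ord_iterE z s a : ord_iter z s a =
  if a == ord_zero then z else
  match pselect (exists2 b, b < a & a = ord_succ b) with
  | left h => let: exist2 b _ _ := cid2 h in s (ord_iter z s b)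
  | right _ => ord_sup (ord_iter z s @` seg a)
  end.
Proof.
rewrite /ord_iter Fix_eq; last first.
  move=> x r r' rr'; suff -> : r = r' by [].
  by apply: functional_extensionality_dep => b; apply/funext => ba.
case: ifP => // _; case: pselect => // h.
congr ord_sup; apply/seteqP; split=> [_ [[b ba] _ <-]|_ [b ba <-]].
  by exists b.
by exists (exist _ b ba).
Qed.

Lemma ord_iter0 z s : ord_iter z s ord_zero = z.
Proof. by rewrite ord_iterE eqxx. Qed.

Lemma ord_iterS z s a : ord_iter z s (ord_succ a) = s (ord_iter z s a).
Proof.
rewrite ord_iterE ifN; last first.
  by apply/eqP => E; have := ord_ge0 a; rewrite -E ord_succ_le ltxx.
case: pselect => [h|[]]; last by exists a; rewrite ?ord_lt_succ.
by case: cid2 => b ba /ord_succ_inj ->.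
Qed.

Lemma ord_iter_lim z s a : ord_limit a ->
  ord_iter z s a = ord_sup (ord_iter z s @` seg a).
Proof.
move=> [/eqP a0 alim]; rewrite ord_iterE ifN //; case: pselect => // -[b ba E].
by move: (alim _ ba); rewrite -E ltxx.
Qed.

Definition ord_add (a b : Ord) : Ord := ord_iter a ord_succ b.
Definition ord_mul (a b : Ord) : Ord := ord_iter ord_zero (fun c => ord_add c a) b.
Definition ord_exp (a b : Ord) : Ord :=
  ord_iter (ord_succ ord_zero) (fun c => ord_mul c a) b.

Definition ord_nat (n : nat) : Ord := iter n ord_succ ord_zero.
Definition omega : Ord := ord_sup (range ord_nat).

Declare Scope ord_scope.
Delimit Scope ord_scope with Ord.
Bind Scope ord_scope with Ord.
Notation "n %:O" := (ord_nat n) (at level 2, left associativity, format "n %:O")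
  : ord_scope.
Notation "a + b" := (ord_add a b) : ord_scope.
Notation "a * b" := (ord_mul a b) : ord_scope.
Notation "a ^ b" := (ord_exp a b) : ord_scope.

(* The ordinal [b] is the space [seg b]. Its own order topology agrees with   *)
(* the subspace topology induced from [Ord], so that a set of ordinals gets   *)
(* the same subspace topology from [Ord] as from any ordinal containing it.   *)
Definition seg_type (b : Ord) : Type := {a : Ord | a < b}.

HB.instance Definition _ b := SubType.on (seg_type b).
HB.instance Definition _ b := [Choice of seg_type b by <:].
HB.instance Definition _ b :=
  [SubChoice_isSubOrder of seg_type b by <: with ord_display].

Lemma seg_topologyE (b : Ord) :
  @open (order_topology (seg_type b)) =
  @open (initial_topology (val : seg_type b -> Ord)).
Proof.
apply/seteqP; split=> U.
  rewrite !openE /interior => + x Ux => /(_ x Ux); rewrite itv_nbhsE /=.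
  case=> -[[[]l|[]] [[]r|[]]] [] //= _; rewrite in_itv /= ?andbT => xlr iU.
  - exists (val @^-1` `]val l, val r[%classic); split.
    + by exists `]val l, val r[%classic => //; exact: itv_open.
    + by rewrite /= in_itv /= ?andbT.
    + by move=> y; rewrite /= in_itv => yi; apply: iU; rewrite /= in_itv.
  - exists (val @^-1` `]val l, +oo[%classic); split.
    + by exists `]val l, +oo[%classic => //; exact: rray_open.
    + by rewrite /= in_itv /= ?andbT.
    + by move=> y; rewrite /= in_itv => yi; apply: iU; rewrite /= in_itv.
  - exists (val @^-1` `]-oo, val r[%classic); split.
    + by exists `]-oo, val r[%classic => //; exact: lray_open.
    + by rewrite /= in_itv /= ?andbT.
    + by move=> y; rewrite /= in_itv => yi; apply: iU; rewrite /= in_itv.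
  - exists setT; split=> //; first by exists setT; [exact: openT|].
    by move=> y _; apply: iU; rewrite /= in_itv.
case=> W oW <-; rewrite openE => x /= Wx.
have : nbhs (val x) W by exact: open_nbhs_nbhs.
rewrite /interior !itv_nbhsE => -[i [oi xi] iW].
suff [j [oj xj ji]] : exists j : interval (order_topology (seg_type b)),
    [/\ itv_open_ends j, x \in j & forall y, y \in j -> val y \in i].
  by exists j => // y /ji /iW.
have lo l : l < b -> exists l' : seg_type b, val l' = l.
  by move=> lb; exists (exist _ l lb : seg_type b).
have xb : val x < b by exact: valP x.
case: i oi xi {iW} => -[[]l|[]] [[]r|[]] //= _; rewrite in_itv /= ?andbT.
- case/andP=> lx xr; have [l' El] := lo l (lt_trans lx xb); subst l.
  have [br|/lo[r' Er]] := leP b r.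
    exists `]l', +oo[; split=> //; first by rewrite in_itv /= andbT.
    move=> y; rewrite !in_itv /= andbT => ly; apply/andP; split => //.
    exact: lt_le_trans (valP y) br.
  subst r; exists `]l', r'[; split=> //.
  by rewrite in_itv /=; apply/andP.
- move=> lx; have [l' El] := lo l (lt_trans lx xb); subst l.
  by exists `]l', +oo[; split=> //; rewrite in_itv /= andbT.
- move=> xr; have [br|/lo[r' Er]] := leP b r.
    exists `]-oo, +oo[; split=> // y _; rewrite in_itv /=.
    exact: lt_le_trans (valP y) br.
  by subst r; exists `]-oo, r'[; split.
- by exists `]-oo, +oo[; split.
Qed.

Definition set_of_ordinals (X : set Ord) : Prop := exists b, X `<=` seg b.

Definition homeomorphism (T U : topologicalType) (X : set T) (Y : set U)
    (f : T -> U) : Prop :=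
  exists g : U -> T,
    [/\ set_fun X Y f, set_fun Y X g, {in X, cancel f g} & {in Y, cancel g f}]
    /\ {within X, continuous f} /\ {within Y, continuous g}.

Definition homeomorphic (X Y : set Ord) : Prop :=
  exists f, homeomorphism X Y f.

Definition order_homeomorphic (X Y : set Ord) : Prop :=
  exists2 f, homeomorphism X Y f & {in X &, {homo f : x y / x <= y}}.

Definition order_reinforcing (a : Ord) : Prop :=
  forall X : set Ord, set_of_ordinals X -> homeomorphic X (seg a) ->
  exists2 Y : set Ord, Y `<=` X & order_homeomorphic Y (seg a).

(* Main.v *)
(* Let [CB X g] be the set of points of [X] of Cantor-Bendixson rank at least *)
(* [g]; it is a topological invariant. An element of [CB X g] above [y] is at *)
(* least [y + omega ^ g], so a set of ordinals with many points of high rank  *)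
(* has large order type, and if it contains its limit points below its        *)
(* supremum then it is order-homeomorphic to this order type. A homeomorph of *)
(* [omega ^ g * m + 1] is compact, hence contains its limit points, and has   *)
(* [m] points of rank [g]. For a homeomorph [X] of [omega ^ g], let [p] be    *)
(* minimal such that [X] has below [p] infinitely many points of each rank    *)
(* [< g]. If [g] is the strict supremum of countably many ordinals, choose    *)
(* points with these ranks increasing to [p], and take the union of disjoint  *)
(* compact neighbourhoods of them. Otherwise closed unbounded subsets of      *)
(* [omega ^ g] meet, so that [X] contains all its limit points below [p].     *)
Require Import Defs.
From mathcomp Require Import all_boot all_order interval all_classical topology.

Set Implicit Arguments.
Unset Strict Implicit.
Unset Printing Implicit Defensive.

Import Order.TTheory.

Local Open Scope classical_set_scope.
Local Open Scope order_scope.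

(** * Ordinal arithmetic *)

(** Cantor-Bendixson rank is a topological invariant ([homeomorphism_CB]) that forces length: a
    point of rank at least [g] above [y] is at least [y + omega ^ g] ([CB_add_le]). On the other
    hand, a set containing those of its limit points that lie below one of its elements is
    order-homeomorphic to its order type ([collapse_homeomorphism]). So it suffices to find in a
    copy [X] a subset closed in this sense with enough points of high rank, and to take an initial
    segment of it ([collapse_initial_segment]).

    A copy of [omega ^ g * m + 1] is compact, hence closed, and its [m] points of rank at least [g]
    make it long enough.

    A copy of [omega ^ g] need not be closed. Take the least [p] below which [X] has infinitely many
    points of each rank [d < g]; such points then also abound between any [q < p] and [p]
    ([big_tail]). If a sequence is cofinal in [g], choose points increasing below [p] whose ranks
    follow it; [X] is locally compact, so suitable disjoint pieces around them have a closed union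
    ([embeds_countable]). If no sequence is cofinal in [g], a limit point [r < p] missing from [X]
    would split [X] into two parts, both with unbounded image in [omega ^ g]. Interleaving the
    images gives a common limit, whose preimage would be a limit from below both of points below [r]
    and of points above [r] ([embeds_uncountable]). *)

Lemma ord_gt0 (x : Ord) : x <> ord_zero -> ord_zero < x.
Proof. by move=> /eqP x0; rewrite lt_neqAle ord_ge0 eq_sym x0. Qed.

Lemma ord_cases (a : Ord) :
  [\/ a = ord_zero, exists b, a = ord_succ b | ord_limit a].
Proof.
have [->|a0] := eqVneq a ord_zero; first by constructor 1.
have [h|/existsNP[b /not_implyP[ba /negP]]] :=
  pselect (forall b, b < a -> ord_succ b < a).
  by constructor 3; split=> //; exact/eqP.
rewrite -leNgt => ab; constructor 2; exists b; apply/le_anti.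
by rewrite ab ord_succ_le.
Qed.

Section Iteration.
Variables (z : Ord) (s : Ord -> Ord).
Hypothesis s_infl : forall x, x <= s x.

Lemma ord_iter_mono a b : b <= a -> ord_iter z s b <= ord_iter z s a.
Proof.
elim/(well_founded_ind ord_wf): a b => a IH b.
rewrite le_eqVlt => /predU1P[->//|ba]; move: IH.
have [a0|[c ac]|alim] := ord_cases a => IH.
- by move: ba; rewrite a0 ltNge ord_ge0.
- rewrite ac ord_iterS; apply: le_trans (s_infl _).
  by apply: IH; [rewrite ac ord_lt_succ|rewrite -ord_lt_succ -ac].
- rewrite (ord_iter_lim _ _ alim).
  exact: (iffLR (ord_sup_segP _ _ _) (lexx _)).
Qed.

(** Merges the zero, successor and limit clauses, so that sums, multiples and powers can be bounded
    without splitting on the shape of [a]. *)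
Lemma ord_iter_leP a x : ord_iter z s a <= x <->
  z <= x /\ forall c, c < a -> s (ord_iter z s c) <= x.
Proof.
split=> [ax|[zx ax]].
  split=> [|c ca].
    apply: le_trans ax; rewrite -{1}(ord_iter0 z s).
    exact/ord_iter_mono/ord_ge0.
  apply: le_trans ax; rewrite -ord_iterS; apply: ord_iter_mono.
  by rewrite ord_succ_le.
have [a0|[c ac]|alim] := ord_cases a.
- by rewrite a0 ord_iter0.
- by rewrite ac ord_iterS ax// ac ord_lt_succ.
- rewrite (ord_iter_lim _ _ alim); apply/ord_sup_segP => c ca.
  exact: le_trans (s_infl _) (ax _ ca).
Qed.

End Iteration.

Lemma ord_addS a b : (a + ord_succ b)%Ord = ord_succ (a + b)%Ord.
Proof. exact: ord_iterS. Qed.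

Lemma ord_add0 a : (a + ord_zero)%Ord = a.
Proof. exact: ord_iter0. Qed.

Lemma ord_add_leP (a b x : Ord) : (a + b)%Ord <= x <->
  a <= x /\ forall c, c < b -> (a + c)%Ord < x.
Proof.
have infl c : c <= ord_succ c by apply: ltW; rewrite ord_lt_succ.
apply: iff_trans (ord_iter_leP a infl b x) _.
by split=> -[ax h]; split=> // c /h; rewrite ord_succ_le.
Qed.

Lemma ord_lt_addP (a b x : Ord) : x < (a + b)%Ord <->
  x < a \/ exists2 c, c < b & x <= (a + c)%Ord.
Proof.
split=> [xab|]; last first.
  case=> [xa|[c cb xac]].
    by apply: lt_le_trans xa _; have [] := iffLR (ord_add_leP a b _) (lexx _).
  apply: le_lt_trans xac _.
  by have [_] := iffLR (ord_add_leP a b _) (lexx _); exact.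
apply: contrapT => /not_orP[/negP xa h]; move: xab; apply/negP; rewrite -leNgt.
rewrite -leNgt in xa; apply/ord_add_leP; split=> // c cb.
by rewrite ltNge; apply/negP => xac; apply: h; exists c.
Qed.

Lemma ord_ltD2l (a b c : Ord) : b < c -> (a + b)%Ord < (a + c)%Ord.
Proof. by move=> bc; apply/ord_lt_addP; right; exists b. Qed.

Lemma ord_leD2l (a b c : Ord) : b <= c -> (a + b)%Ord <= (a + c)%Ord.
Proof.
by rewrite le_eqVlt => /predU1P[->//|bc]; exact/ltW/ord_ltD2l.
Qed.

Lemma ord_leDl (a b : Ord) : a <= (a + b)%Ord.
Proof. by rewrite -{1}[a]ord_add0; exact/ord_leD2l/ord_ge0. Qed.

Lemma ord_leD2r (a b c : Ord) : a <= b -> (a + c)%Ord <= (b + c)%Ord.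
Proof.
move=> ab; elim/(well_founded_ind ord_wf): c => c IH.
apply/ord_add_leP; split; first exact: le_trans (ord_leDl _ _).
by move=> d dc; apply: le_lt_trans (IH d dc) (ord_ltD2l _ dc).
Qed.

Lemma ord_leDr (a b : Ord) : b <= (a + b)%Ord.
Proof.
rewrite leNgt; apply/negP.
elim/(well_founded_ind ord_wf): b => b IH ab.
by apply: (IH (a + b)%Ord) => //; exact: ord_ltD2l.
Qed.

Lemma ord_add0l (a : Ord) : (ord_zero + a)%Ord = a.
Proof.
apply/le_anti; rewrite ord_leDr andbT.
elim/(well_founded_ind ord_wf): a => a IH; apply/ord_add_leP.
by split=> [|c ca]; [exact: ord_ge0|exact: le_lt_trans (IH c ca) ca].
Qed.

Lemma ord_addA (a b c : Ord) : (a + (b + c))%Ord = ((a + b) + c)%Ord.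
Proof.
elim/(well_founded_ind ord_wf): c => c IH; apply/le_anti/andP; split.
  apply/ord_add_leP; split.
    exact: le_trans (ord_leDl a b) (ord_leDl _ _).
  move=> d /ord_lt_addP[db|[e ec de]].
    exact: lt_le_trans (ord_ltD2l _ db) (ord_leDl _ _).
  apply: le_lt_trans (ord_leD2l _ de) _.
  by rewrite IH//; exact: ord_ltD2l.
apply/ord_add_leP; split=> [|d dc]; first exact/ord_leD2l/ord_leDl.
by rewrite -IH//; apply/ord_ltD2l/ord_ltD2l.
Qed.

Lemma ord_mul0 (a : Ord) : (a * 0%:O)%Ord = ord_zero.
Proof. exact: ord_iter0. Qed.

Lemma ord_mulS (a : Ord) n : (a * n.+1%:O)%Ord = (a * n%:O + a)%Ord.
Proof. exact: ord_iterS. Qed.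

Lemma ord_nat_lt m n : (m < n)%N -> ord_nat m < ord_nat n.
Proof.
elim: n => // n IH; rewrite ltnS leq_eqVlt => /predU1P[->|/IH mn].
  by rewrite ord_lt_succ.
by rewrite ord_lt_succ ltW.
Qed.

Lemma ord_lt_omegaP (a : Ord) : a < omega <-> exists n, a = ord_nat n.
Proof.
have le_omega n : ord_nat n <= omega.
  exact: (iffLR (ord_supP _ _) (lexx _)).
split=> [aw|[n ->]]; last first.
  by apply: lt_le_trans (le_omega n.+1); exact: ord_nat_lt.
have [n an] : exists n, a < ord_nat n.
  apply: contrapT => /forallNP h; move: aw; apply/negP; rewrite -leNgt.
  by apply/ord_supP => n; rewrite leNgt; exact/negP/h.
elim: n an => [|n IH]; first by rewrite ltNge ord_ge0.
by rewrite ord_lt_succ le_eqVlt => /predU1P[->|//]; exists n.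
Qed.

Lemma ord_mul_omega_leP (a x : Ord) :
  (a * omega)%Ord <= x <-> forall n, (a * n%:O)%Ord <= x.
Proof.
have infl c : c <= (c + a)%Ord by exact: ord_leDl.
apply: iff_trans (ord_iter_leP ord_zero infl omega x) _; split=> [[_ h] n|h].
  by apply: le_trans (infl _) (h _ _); apply/ord_lt_omegaP; exists n.
split=> [|c /ord_lt_omegaP[n ->]]; first exact: ord_ge0.
by rewrite -[X in X <= _](ord_mulS a n).
Qed.

Lemma ord_le_mul2l (a b : Ord) n : a <= b -> (a * n%:O)%Ord <= (b * n%:O)%Ord.
Proof.
move=> ab; elim: n => [|n IH]; first by rewrite !ord_mul0.
rewrite !ord_mulS; exact: le_trans (ord_leD2r _ IH) (ord_leD2l _ ab).
Qed.

Lemma ord_mul1 (a : Ord) : (a * 1%:O)%Ord = a.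
Proof. by rewrite ord_mulS ord_mul0 ord_add0l. Qed.

Lemma ord_exp_infl (a : Ord) : a <= (a * omega)%Ord.
Proof.
by rewrite -{1}(ord_mul1 a); exact: (iffLR (ord_mul_omega_leP _ _) (lexx _)).
Qed.

(** * Bounds by powers of omega *)

Lemma omega_exp_leP (g x : Ord) : (omega ^ g)%Ord <= x <->
  ord_zero < x /\ forall d n, d < g -> (omega ^ d * n%:O)%Ord <= x.
Proof.
apply: iff_trans (ord_iter_leP _ ord_exp_infl g x) _; rewrite ord_succ_le.
split=> -[x0 h]; split=> //; first by move=> d n /h/ord_mul_omega_leP.
by move=> c cg; apply/ord_mul_omega_leP => n; exact: h.
Qed.

Lemma omega_exp_mono (d g : Ord) : d <= g -> (omega ^ d)%Ord <= (omega ^ g)%Ord.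
Proof. exact/ord_iter_mono/ord_exp_infl. Qed.

Lemma omega_exp_gt0 (g : Ord) : ord_zero < (omega ^ g)%Ord.
Proof. by have [] := iffLR (omega_exp_leP g _) (lexx _). Qed.

Lemma ord_lt_mulS (g : Ord) n :
  (omega ^ g * n%:O)%Ord < (omega ^ g * n.+1%:O)%Ord.
Proof.
by rewrite ord_mulS -{1}[X in X < _]ord_add0; exact/ord_ltD2l/omega_exp_gt0.
Qed.

Lemma omega_exp_mul_lt (d g : Ord) n : d < g ->
  (omega ^ d * n%:O)%Ord < (omega ^ g)%Ord.
Proof.
move=> dg; apply: lt_le_trans (ord_lt_mulS _ _) _.
by have [_] := iffLR (omega_exp_leP g _) (lexx _); exact.
Qed.

Lemma omega_exp_ltP (g x : Ord) : g <> ord_zero -> x < (omega ^ g)%Ord <->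
  exists d n, d < g /\ x < (omega ^ d * n%:O)%Ord.
Proof.
move=> g0; split=> [xg|[d [n [dg xd]]]]; last first.
  exact: lt_trans xd (omega_exp_mul_lt _ dg).
apply: contrapT => h; move: xg; apply/negP; rewrite -leNgt.
have le_x d n : d < g -> (omega ^ d * n%:O)%Ord <= x.
  by move=> dg; rewrite leNgt; apply/negP => xd; apply: h; exists d, n.
apply/omega_exp_leP; split=> //.
have g_gt0 := ord_gt0 g0.
apply: lt_le_trans (omega_exp_gt0 ord_zero) _.
by rewrite -[X in X <= _]ord_mul1; exact: le_x.
Qed.

Lemma ord_add_omega_exp_le (y g x : Ord) : y < x ->
  (forall d n, d < g -> (y + omega ^ d * n%:O)%Ord <= x) ->
  (y + omega ^ g)%Ord <= x.
Proof.
move=> yx h; apply/ord_add_leP; split=> [|c cg]; first exact: ltW.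
have [g0|g0] := pselect (g = ord_zero).
  move: cg; rewrite g0 [X in _ < X](ord_iter0) ord_lt_succ => c0.
  by apply: le_lt_trans (ord_leD2l _ c0) _; rewrite ord_add0.
have [d [n [dg cd]]] := iffLR (omega_exp_ltP _ g0) cg.
exact: lt_le_trans (ord_ltD2l _ cd) (h _ _ dg).
Qed.

(** * Limit points and Cantor-Bendixson rank *)

(** Limits come only from below because [[0, x]] is open. Zero is excluded explicitly, as the second
    clause is vacuous there. *)
Definition acc (E : set Ord) (x : Ord) : Prop :=
  x <> ord_zero /\ forall q, q < x -> exists z, [/\ E z, q < z & z < x].

Lemma acc_sub (E F : set Ord) x : E `<=` F -> acc E x -> acc F x.
Proof.
move=> EF [x0 h]; split=> // q /h[z [Ez qz zx]]; exists z; split=> //.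
exact: EF.
Qed.

(* The points of [X] of Cantor-Bendixson rank at least [g]. *)
Definition CB (X : set Ord) : Ord -> set Ord :=
  Fix ord_wf (fun _ => set Ord)
    (fun g r => [set x | X x /\ forall d (dg : d < g), acc (r d dg) x]).

Lemma CBP X g x : CB X g x <-> X x /\ forall d, d < g -> acc (CB X d) x.
Proof.
rewrite /CB Fix_eq // => {}g r r' rr'; suff -> : r = r' by [].
by apply: functional_extensionality_dep => b; apply/funext => ba.
Qed.

Lemma CB_le X g d : d <= g -> CB X g `<=` CB X d.
Proof.
move=> dg x /CBP[Xx h]; apply/CBP; split=> // e ed.
by apply: h; exact: lt_le_trans dg.
Qed.

Lemma CB_subset X g : CB X g `<=` X.
Proof. by move=> x /CBP[]. Qed.

(** Rank is local. Openness of [U] is asked only to the left, where limits come from. This keeps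
    ranks when [X] is cut down to a subset. *)
Lemma CB_local X Y (U : set Ord) g :
  (forall x, U x -> x <> ord_zero ->
    exists2 q, q < x & forall z, q < z -> z < x -> U z) ->
  X `&` U `<=` Y -> CB X g `&` U `<=` CB Y g.
Proof.
move=> Uo XUY; elim/(well_founded_ind ord_wf): g => g IH x [/CBP[Xx h] Ux].
apply/CBP; split; first exact: XUY.
move=> d dg; have [x0 hd] := h d dg; split=> // q qx.
have [q' q'x qU] := Uo x Ux x0.
have [z [Xz qz zx]] : exists z, [/\ CB X d z, Order.max q q' < z & z < x].
  by apply: hd; rewrite gt_max qx.
move: qz; rewrite gt_max => /andP[qz q'z].
by exists z; split=> //; apply: IH => //; split=> //; exact: qU.
Qed.

(** For [d < g], points of rank [d] accumulate at [x]; moving [n] times from [y] to a further one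
    gains [omega ^ d * n] and stays below [x]. *)
Lemma CB_add_le X g x y : CB X g x -> y < x -> (y + omega ^ g)%Ord <= x.
Proof.
elim/(well_founded_ind ord_wf): g x y => g IH x y /CBP[Xx h] yx.
apply: ord_add_omega_exp_le => // d n dg; apply: ltW.
have [_ hd] := h d dg.
elim: n => [|n IHn]; first by rewrite ord_mul0 ord_add0.
have [z [zd nz zx]] := hd _ IHn.
by rewrite ord_mulS ord_addA; apply: le_lt_trans zx; exact: IH.
Qed.

Lemma CB_seg (a g y : Ord) : (y + omega ^ g)%Ord < a ->
  CB (seg a) g (y + omega ^ g)%Ord.
Proof.
elim/(well_founded_ind ord_wf): g y => g IH y ya; apply/CBP; split=> // d dg.
have ylt : y < (y + omega ^ g)%Ord.
  by rewrite -{1}[y]ord_add0; exact/ord_ltD2l/omega_exp_gt0.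
have add_lt q : q < (y + omega ^ g)%Ord ->
    (q + omega ^ d)%Ord < (y + omega ^ g)%Ord.
  move=> qx; have [qy|yq] := ltP q y.
    apply: le_lt_trans (ord_leD2r _ (ltW qy)) (ord_ltD2l _ _).
    by have := omega_exp_mul_lt 1 dg; rewrite ord_mul1.
  suff [e [n [eg qe]]] : exists e n, e < g /\ q < (y + omega ^ e * n%:O)%Ord.
    (* The larger exponent absorbs both the bound on [q] and the step [omega ^ d]. *)
    set f := Order.max d e.
    have fg : f < g by rewrite gt_max dg.
    apply: (@le_lt_trans _ _ (y + omega ^ f * n.+1%:O)%Ord); last first.
      exact/ord_ltD2l/omega_exp_mul_lt.
    rewrite ord_mulS ord_addA.
    have ef : (omega ^ e * n%:O)%Ord <= (omega ^ f * n%:O)%Ord.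
      by apply/ord_le_mul2l/omega_exp_mono; rewrite le_max lexx orbT.
    apply: le_trans (ord_leD2r _ (le_trans (ltW qe) (ord_leD2l y ef))) _.
    by apply/ord_leD2l/omega_exp_mono; rewrite le_max lexx.
  apply: contrapT => h; move: qx; apply/negP; rewrite -leNgt.
  have le_q e n : e < g -> (y + omega ^ e * n%:O)%Ord <= q.
    by move=> eg; rewrite leNgt; apply/negP => qe; apply: h; exists e, n.
  apply: ord_add_omega_exp_le => //.
  apply: lt_le_trans (le_q d 1 dg); rewrite ord_mul1 -{1}[y]ord_add0.
  exact/ord_ltD2l/omega_exp_gt0.
split=> [E|q qx]; first by move: ylt; rewrite E ltNge ord_ge0.
exists ((Order.max q y) + omega ^ d)%Ord.
have mx : Order.max q y < (y + omega ^ g)%Ord by rewrite gt_max qx.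
split; [|apply: le_lt_trans (_ : Order.max q y < _)|exact: add_lt].
- by apply: IH => //; apply: lt_trans (add_lt _ mx) ya.
- by rewrite le_max lexx.
- by rewrite -{1}[Order.max q y]ord_add0; exact/ord_ltD2l/omega_exp_gt0.
Qed.

(** Each block from [omega ^ g * n] to [omega ^ g * n.+1] holds at most one such point: by
    [CB_add_le] a second one would lie past the end. *)
Lemma CB_finite X g n :
  finite_set (CB X g `&` [set x | x < (omega ^ g * n%:O)%Ord]).
Proof.
elim: n => [|n IH].
  apply: (@sub_finite_set _ _ set0) => // x [_].
  by rewrite /= ord_mul0 ltNge ord_ge0.
set J := CB X g `&` [set x | (omega ^ g * n%:O)%Ord <= x /\
  x < (omega ^ g * n.+1%:O)%Ord].
apply: (@sub_finite_set _ _ ((CB X g `&` [set x | x < (omega ^ g * n%:O)%Ord])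
    `|` J)).
  move=> x [Xx /= xn]; have [xl|xg] := ltP x (omega ^ g * n%:O)%Ord.
    by left.
  by right.
rewrite finite_setU; split=> //.
have [[a Ja]|/forallNP J0] := pselect (exists a, J a); last first.
  by apply: (@sub_finite_set _ _ set0) => // x /J0.
apply: (@sub_finite_set _ _ [set a]); last exact: finite_set1.
have incomp x y : J x -> J y -> ~ x < y.
  move=> [_ [nx _]] [Xy [_ yn]] /(CB_add_le Xy) xy.
  move: yn; rewrite ltNge ord_mulS => /negP; apply.
  exact: le_trans (ord_leD2r _ nx) xy.
move=> x Jx /=; apply/eqP; rewrite eq_le !leNgt.
by apply/andP; split; apply/negP; exact: incomp.
Qed.

Lemma CB_bounded_finite X g b : b < (omega ^ g)%Ord -> g <> ord_zero ->
  exists2 d, d < g & finite_set (CB X d `&` [set x | x <= b]).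
Proof.
move=> bg g0; have [d [n [dg bd]]] := iffLR (omega_exp_ltP b g0) bg.
exists d => //.
apply: sub_finite_set (CB_finite X d n) => x [Xx xb]; split=> //.
exact: le_lt_trans bd.
Qed.

Lemma incr_seq_lt (u : nat -> Ord) : (forall n, u n < u n.+1) ->
  {homo u : m n / (m < n)%N >-> m < n}.
Proof. by move=> u_incr; apply: homo_ltn => //; exact: lt_trans. Qed.

Lemma infinite_range_incr (u : nat -> Ord) :
  (forall n, u n < u n.+1) -> infinite_set (range u).
Proof.
move=> /incr_seq_lt u_incr.
have uE : (range u #= [set: nat])%card.
  apply: (@inj_card_eq _ _ [set: nat] u) => m n _ _ E.
  by have [/u_incr|/u_incr|//] := ltngtP m n; rewrite E ltxx.
by rewrite (eq_finite_set uE); exact: infinite_nat.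
Qed.

Lemma CB_omega_exp_infinite (g d : Ord) : d < g ->
  infinite_set (CB (seg (omega ^ g)%Ord) d).
Proof.
move=> dg; apply: sub_infinite_set
  (@infinite_range_incr (fun n => (omega ^ d * n.+1%:O)%Ord) _) => [_ [n _ <-]|n].
  by rewrite ord_mulS; apply: CB_seg; rewrite -ord_mulS; exact: omega_exp_mul_lt.
exact: ord_lt_mulS.
Qed.

Lemma CB_sorted_le X g (s : seq Ord) : g <> ord_zero ->
  path <%O ord_zero s -> (forall x, x \in s -> CB X g x) ->
  (omega ^ g * (size s)%:O)%Ord <= last ord_zero s.
Proof.
move=> g0; elim/last_ind: s => [|s x IH]; first by rewrite /= ord_mul0.
rewrite rcons_path size_rcons last_rcons => /andP[ps lx] sX.
have {}IH : (omega ^ g * (size s)%:O)%Ord <= last ord_zero s.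
  by apply: IH => // y ys; apply: sX; rewrite mem_rcons inE ys orbT.
rewrite ord_mulS; apply: le_trans (ord_leD2r _ IH) _.
by apply: CB_add_le lx; apply: sX; rewrite mem_rcons inE eqxx.
Qed.

(** * Neighbourhoods, continuity and compactness in the order topology *)

Lemma ord_nbhsP (x : Ord) (U : set Ord) : nbhs x U <->
  (forall z, z <= x -> U z) \/
  exists2 q, q < x & forall z, q < z -> z <= x -> U z.
Proof.
rewrite itv_nbhsE; split.
  case=> -[[[]l|[]] [[]r|[]]] [] //= _; rewrite in_itv /= ?andbT => xlr iU.
  - case/andP: xlr => lx xr; right; exists l => // z lz zx; apply: iU.
    by rewrite /= in_itv /= lz (le_lt_trans zx).
  - by right; exists l => // z lz zx; apply: iU; rewrite /= in_itv /= lz.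
  - by left => z zx; apply: iU; rewrite /= in_itv /= (le_lt_trans zx).
  - by left => z zx; apply: iU.
case=> [h|[q qx h]].
  exists (interval.Interval -oo%O (interval.BLeft (ord_succ x))).
    by split=> //; rewrite in_itv /= ord_lt_succ.
  by move=> z; rewrite /= in_itv /= ord_lt_succ; exact: h.
exists (interval.Interval (interval.BRight q) (interval.BLeft (ord_succ x))).
  by split=> //; rewrite in_itv /= ord_lt_succ qx /=.
by move=> z; rewrite /= in_itv /= ord_lt_succ => /andP[]; exact: h.
Qed.

(** Injectivity keeps nearby values different from [f x], and since [[0, f x]] is open they do not
    exceed it. *)
Lemma within_continuous_acc (f : Ord -> Ord) (X E : set Ord) x :
  {within X, continuous f} -> {in X &, injective f} -> E `<=` X ->
  X x -> acc E x -> acc (f @` E) (f x).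
Proof.
move=> /subspace_continuousP cf injf EX Xx [x0 hx].
have key U : nbhs (f x) U -> exists z, [/\ E z, f z != f x & U (f z)].
  move=> /(cf x Xx)/ord_nbhsP fU.
  suff [z [Ez zx]] : exists z, [/\ E z, z < x & X z -> U (f z)].
    move=> /(_ (EX _ Ez)) Uz; exists z; split=> //; apply/eqP => E1.
    by move: zx; rewrite (injf z x _ _ E1) ?ltxx// inE//; exact: EX.
  have xpos := ord_gt0 x0.
  case: fU => [h|[q qx h]].
    by have [z [Ez _ zx]] := hx _ xpos; exists z; split=> //; exact/h/ltW.
  by have [z [Ez qz zx]] := hx _ qx; exists z; split=> //; apply: h => //;
    exact/ltW.
split=> [f0|q qx].
  have [|z [Ez zx /eqP fz]] := key [set ord_zero].
    apply/ord_nbhsP; left => z; rewrite f0 => z0.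
    by apply/eqP; rewrite eq_le z0 ord_ge0.
  by move: zx; rewrite f0 fz.
have [|z [Ez zx [qz fzx]]] := key [set y | q < y /\ y <= f x].
  by apply/ord_nbhsP; right; exists q.
by exists (f z); split=> //; rewrite lt_neqAle zx.
Qed.

Lemma homeomorphism_CB (X Z : set Ord) (f : Ord -> Ord) g x :
  homeomorphism X Z f -> CB X g x -> CB Z g (f x).
Proof.
move=> [f' [[fXZ _ fK _] [cf _]]]; have injf := can_in_inj fK.
elim/(well_founded_ind ord_wf): g x => g IH x /CBP[Xx h]; apply/CBP.
split=> [|d dg]; first exact: fXZ.
apply: acc_sub (within_continuous_acc cf injf (@CB_subset X d) Xx (h d dg)).
by move=> _ [z Xz <-]; exact: IH.
Qed.

(** The least [c] such that every member of the filter meets [[0, c]] is a cluster point: for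
    [q < c] some member misses [[0, q]], and intersecting with it forces points into [(q, c]]. *)
Lemma ord_segment_compact (a : Ord) : compact [set x : Ord | x <= a].
Proof.
move=> F PF Fa.
pose P := [set b : Ord | forall B, F B -> exists2 z, B z & z <= b].
have Pa : P a.
  move=> B FB; have [z [Bz za]] := filter_ex (filterI FB Fa); by exists z.
have [c Pc cmin] := ord_minP (ex_intro P a Pa).
exists c; split; first exact: cmin.
move=> B U FB /ord_nbhsP[h|[q qc h]].
  by have [z Bz zc] := Pc B FB; exists z; split=> //; exact: h.
have : ~ P q by move=> /cmin; rewrite leNgt qc.
move=> /existsNP[C /not_implyP[FC Cq]].
have [z [Bz Cz] zc] := Pc _ (filterI FB FC); exists z; split=> //.
by apply: h => //; rewrite ltNge; apply/negP => zq; apply: Cq; exists z.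
Qed.

Lemma acc_image_segment (g : Ord -> Ord) (a d r : Ord) :
  {within seg a, continuous g} -> d < a ->
  acc (g @` [set x | x <= d]) r -> (g @` [set x | x <= d]) r.
Proof.
move=> cg da [r0 hr].
have cK : compact (g @` [set x | x <= d]).
  apply: continuous_compact (@ord_segment_compact d).
  by apply: continuous_subspaceW cg => x /= xd; exact: le_lt_trans da.
have clK := compact_closed (@order_hausdorff _ Ord) cK.
apply: clK => U /ord_nbhsP Ur.
have rpos := ord_gt0 r0.
case: Ur => [h|[q qr h]].
  by have [z [Ez _ zx]] := hr _ rpos; exists z; split=> //; exact/h/ltW.
by have [z [Ez qz zx]] := hr _ qr; exists z; split=> //; apply: h => //;
    exact/ltW.
Qed.

(** * Collapsing a set of ordinals onto its order type *)

(* [collapse Y x] is the order type of [Y `&` seg x]. *)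
Definition collapse (Y : set Ord) : Ord -> Ord :=
  Fix ord_wf (fun _ => Ord) (fun x r => ord_sup
    [set if `[< Y (val y) >] then ord_succ (r (val y) (valP y)) else ord_zero
      | y in [set: {y : Ord | y < x}]]).

Lemma collapse_leP (Y : set Ord) x b : collapse Y x <= b <->
  forall y, Y y -> y < x -> collapse Y y < b.
Proof.
have -> : collapse Y x = ord_sup
    ((fun y => if `[< Y y >] then ord_succ (collapse Y y) else ord_zero) @` seg x).
  rewrite /collapse Fix_eq; last first.
    move=> {}x r r' rr'; suff -> : r = r' by [].
    by apply: functional_extensionality_dep => c; apply/funext => cx.
  congr ord_sup; apply/seteqP; split=> [_ [[c cx] _ <-]|_ [c cx <-]].
    by exists c.
  by exists (exist _ c cx).
apply: iff_trans (ord_sup_segP _ _ _) _; split=> h y.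
  by move=> Yy /h; case: asboolP => // _; rewrite ord_succ_le.
by move=> yx; case: asboolP => [Yy|_]; [rewrite ord_succ_le h|exact: ord_ge0].
Qed.

Lemma collapse_lt (Y : set Ord) x y :
  Y y -> y < x -> collapse Y y < collapse Y x.
Proof. by move=> Yy yx; exact: (iffLR (collapse_leP Y x _) (lexx _)). Qed.

Lemma collapse_le (Y : set Ord) x y : y <= x -> collapse Y y <= collapse Y x.
Proof.
move=> yx; apply/collapse_leP => z Yz zy; apply: collapse_lt => //.
exact: lt_le_trans yx.
Qed.

Lemma collapse_lt_inv (Y : set Ord) x y : collapse Y y < collapse Y x -> y < x.
Proof. by rewrite !ltNge; apply: contra; exact: collapse_le. Qed.

Lemma collapse_surj (Y : set Ord) x b :
  b < collapse Y x -> exists y, [/\ Y y, y < x & collapse Y y = b].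
Proof.
elim/(well_founded_ind ord_wf): x => x IH bx.
have [y [Yy yx]] : exists y, [/\ Y y, y < x & b <= collapse Y y].
  apply: contrapT => h; move: bx; apply/negP; rewrite -leNgt.
  apply/collapse_leP => y Yy yx; rewrite ltNge; apply/negP => yb.
  by apply: h; exists y.
rewrite le_eqVlt => /predU1P[->|/(IH _ yx)[z [Yz zy zb]]]; first by exists y.
by exists z; split=> //; exact: lt_trans yx.
Qed.

(** The supremum of [Y] may be missing. Excluded is for instance [seg omega] with [omega + 1] added,
    whose collapse has a discontinuous inverse. *)
Definition acc_closed (Y : set Ord) : Prop :=
  forall r y, acc Y r -> Y y -> r < y -> Y r.

(** The collapse is continuous because its values leave no gaps; [acc_closed] serves the continuity
    of its inverse. *)
Lemma collapse_homeomorphism (Y : set Ord) b : acc_closed Y -> Y `<=` seg b ->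
  homeomorphism Y (seg (collapse Y b)) (collapse Y).
Proof.
move=> Ycl Yb; set h := collapse Y; set c := h b.
have /choice[g gP] (a : Ord) : exists y, a < c -> Y y /\ h y = a.
  have [ac|_] := ltP a c; last by exists a.
  by have [y [Yy _ ya]] := collapse_surj ac; exists y.
have hYc y : Y y -> h y < c by move=> Yy; apply: collapse_lt => //; exact: Yb.
have h_inj y y' : Y y -> Y y' -> h y = h y' -> y = y'.
  move=> Yy Yy' E; have [/(collapse_lt Yy)|/(collapse_lt Yy')|//] := ltgtP y y'.
    by rewrite -/h E ltxx.
  by rewrite -/h E ltxx.
exists g; split; [split=> //|split; apply/subspace_continuousP].
- by move=> a /gP[].
- move=> y; rewrite inE => Yy; have [Yg gE] := gP _ (hYc _ Yy); exact: h_inj.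
- by move=> a; rewrite inE => /gP[].
- move=> y Yy U /ord_nbhsP hU; apply/ord_nbhsP.
  case: hU => [hU|[q qy hU]].
    by left => z zy Yz; apply: hU; exact: collapse_le.
  have [y' [Yy' y'y hq]] := collapse_surj qy.
  right; exists y' => // z y'z zy Yz; apply: hU; last exact: collapse_le.
  by rewrite -hq; exact: collapse_lt.
- move=> a ac U /ord_nbhsP gU; have [Yg gE] := gP _ ac; apply/ord_nbhsP.
  have g_le z : z <= a -> z < c -> g z <= g a.
    move=> za zc; have [Yz zE] := gP _ zc.
    by rewrite leNgt; apply/negP => /(collapse_lt Yg); rewrite -/h zE gE ltNge za.
  case: gU => [gU|[q qg gU]]; first by left => z za zc; exact/gU/g_le.
  have lt_a y' : Y y' -> y' < g a -> h y' < a.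
    by move=> Yy' /(collapse_lt Yy'); rewrite -/h gE.
  have [[y' [Yy' qy' y'g]]|nex] := pselect (exists y', [/\ Y y', q <= y' & y' < g a]).
    right; exists (h y'); first exact: lt_a.
    move=> z hz za zc; apply: gU; last exact: g_le.
    apply: le_lt_trans qy' _; apply: (@collapse_lt_inv Y).
    by have [_] := gP _ zc; rewrite /h => ->.
  have le_q y' : Y y' -> y' < g a -> y' < q.
    by move=> Yy' y'g; rewrite ltNge; apply/negP => qy'; apply: nex; exists y'.
  (* Now [Y] has no element in [[q, g a)], so the least strict upper bound [r] of its elements below
     [g a] is at most [q]. Were [r] a limit point of [Y], closedness would put it in [Y], strictly
     below itself. *)
  have [r rub rmin] := ord_minP
    (ex_intro (fun r => forall y', Y y' -> y' < g a -> y' < r) q le_q).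
  have rg : r < g a by apply: le_lt_trans qg; exact: rmin.
  have nacc : ~ acc Y r.
    move=> /Ycl/(_ Yg rg) Yr; have := rub _ Yr rg; by rewrite ltxx.
  (* [r] is not a limit, so [Y `&` seg (g a)] is empty or has a maximum. *)
  have [r0|r0] := pselect (r = ord_zero).
    have h0 : forall z, z < a -> False.
      move=> z za; have zc := lt_trans za ac; have [Yz zE] := gP _ zc.
      have zg : g z < g a by apply: (@collapse_lt_inv Y); rewrite -/h zE gE.
      by have := rub _ Yz zg; rewrite r0 ltNge ord_ge0.
    left=> z za zc; apply: gU; last exact: g_le.
    by move: za; rewrite le_eqVlt => /predU1P[->//|/h0].
  have [p pr pmax] : exists2 p, p < r & forall z, Y z -> z < r -> z <= p.
    apply: contrapT => hp; apply: nacc; split=> // p pr.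
    apply: contrapT => hz; apply: hp; exists p => // z Yz zr.
    by rewrite leNgt; apply/negP => pz; apply: hz; exists z.
  (* Otherwise [p] would be a smaller strict upper bound. *)
  have [y' Yy' [y'g py']] : exists2 y', Y y' & y' < g a /\ p <= y'.
    apply: contrapT => hy; move: pr; apply/negP; rewrite -leNgt.
    apply: rmin => y' Yy' y'g; rewrite ltNge; apply/negP => py'.
    by apply: hy; exists y'.
  right; exists (h y'); first exact: lt_a.
  move=> z hz za zc; apply: gU; last exact: g_le.
  have [Yz zE] := gP _ zc; rewrite ltNge; apply/negP => zq.
  have zg : g z < g a by exact: le_lt_trans qg.
  have := pmax _ Yz (rub _ Yz zg); rewrite leNgt => /negP; apply.
  by apply: le_lt_trans py' _; apply: (@collapse_lt_inv Y); rewrite -/h zE.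
Qed.

Lemma collapse_initial_segment (Y : set Ord) b a : acc_closed Y ->
  Y `<=` seg b -> a <= collapse Y b ->
  exists2 Z : set Ord, Z `<=` Y & order_homeomorphic Z (seg a).
Proof.
move=> Ycl Yb ab.
have [g [[fYc gcY fK gK] [cf cg]]] := collapse_homeomorphism Ycl Yb.
have sub_c : seg a `<=` seg (collapse Y b).
  by move=> x xa; exact: lt_le_trans ab.
exists (Y `&` [set y | collapse Y y < a]); first by move=> y [].
exists (collapse Y); last by move=> x y _ _; exact: collapse_le.
exists g; split; [split|split].
- by move=> y [].
- move=> x xa; split; first exact/gcY/sub_c.
  by rewrite /= gK// inE; exact: sub_c.
- by move=> y; rewrite inE => -[Yy _]; apply: fK; rewrite inE.
- by move=> x; rewrite inE => xa; apply: gK; rewrite inE; exact: sub_c.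
- by apply: continuous_subspaceW cf => y [].
- exact: continuous_subspaceW cg.
Qed.

(** * Order-reinforcing ordinals *)

Lemma infinite_image_inj (A : set Ord) (f : Ord -> Ord) :
  {in A &, injective f} -> infinite_set A -> infinite_set (f @` A).
Proof. by move=> f_inj; rewrite (eq_finite_set (inj_card_eq f_inj)). Qed.

Lemma homeomorphism_CB_infinite (X Z : set Ord) (f : Ord -> Ord) d (A : set Ord) :
  homeomorphism X Z f -> infinite_set (CB X d `&` A) ->
  infinite_set (CB Z d `&` f @` (CB X d `&` A)).
Proof.
move=> hf; have [? [[_ _ fK _] _]] := hf.
move=> /(@infinite_image_inj _ f) H; apply: sub_infinite_set (H _).
  by move=> _ [z [Xz Az] <-]; split; [exact: homeomorphism_CB Xz|exists z].
move=> x y; rewrite !inE => -[/CB_subset Xx _] [/CB_subset Xy _].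
by apply: (can_in_inj fK); rewrite inE.
Qed.

(** * The compact case *)

Lemma order_reinforcing_omega_exp_mul_succ (g : Ord) (m : nat) :
  g <> ord_zero -> (0 < m)%N ->
  order_reinforcing (omega ^ g * m%:O + 1%:O)%Ord.
Proof.
move=> g_neq0 m_gt0 X [b Xb] [f hf]; set w := (omega ^ g * m%:O)%Ord.
have wE : (w + 1%:O)%Ord = ord_succ w by rewrite ord_addS ord_add0.
rewrite -/w wE in hf *.
have [k [[fX kX fK kK] [cf ck]]] := hf.
have hk : homeomorphism (seg (ord_succ w)) X k by exists f.
have Xcl : acc_closed X.
  move=> r y accX _ _.
  suff [z zw <-] : (k @` [set x | x <= w]) r by apply: kX;
    rewrite /= /seg /= ord_lt_succ.
  apply: acc_image_segment ck _ _; first by rewrite ord_lt_succ.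
  apply: acc_sub accX => z Xz; exists (f z); last by rewrite fK// inE.
  by rewrite /= -ord_lt_succ; exact: fX.
have hh := collapse_homeomorphism Xcl Xb.
set h := collapse X; set c := h b.
suff wc : ord_succ w <= c by exact: collapse_initial_segment wc.
have [? [[_ _ hK _] _]] := hh.
pose pt n := (omega ^ g * n.+1%:O)%Ord.
have pt_lt n : (n < m)%N -> pt n < ord_succ w.
  rewrite /pt ord_lt_succ => nm.
  have := incr_seq_lt (ord_lt_mulS g) ; rewrite le_eqVlt.
  move: nm; rewrite leq_eqVlt => /predU1P[-> _|nm /(_ _ _ nm) ->].
    by rewrite eqxx.
  by rewrite orbT.
have ptCB n : (n < m)%N -> CB (seg c) g (h (k (pt n))).
  move=> nm; apply: homeomorphism_CB hh _; apply: homeomorphism_CB hk _.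
  rewrite /pt ord_mulS; apply: CB_seg; rewrite -ord_mulS; exact: pt_lt.
(* [k] need not preserve the order, so the images are sorted; the largest is at least [w] and lies
   in [seg c]. *)
pose s := sort <=%O [seq h (k (pt n)) | n <- iota 0 m].
have sCB x : x \in s -> CB (seg c) g x.
  rewrite mem_sort => /mapP[n]; rewrite mem_iota add0n => /= nm ->.
  exact: ptCB.
have size_s : size s = m by rewrite size_sort size_map size_iota.
have s_path : path <%O ord_zero s.
  rewrite (path_sortedE lt_trans); apply/andP; split.
    apply/allP => x /sCB /CBP[_ /(_ ord_zero (ord_gt0 g_neq0))[x0 _]].
    exact: ord_gt0.
  rewrite sort_lt_sorted map_inj_in_uniq ?iota_uniq// => i j.
  rewrite !mem_iota !add0n => /= im jm E.
  have E1 : k (pt i) = k (pt j).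
    apply: (can_in_inj hK) E; rewrite inE; exact/kX/pt_lt.
  have E2 : pt i = pt j.
    by apply: (can_in_inj kK) E1; rewrite inE; exact: pt_lt.
  have pt_mono : {homo pt : i j / (i < j)%N >-> i < j}.
    by apply: incr_seq_lt => n; exact: ord_lt_mulS.
  by have [/pt_mono|/pt_mono|//] := ltngtP i j; rewrite E2 ltxx.
have := CB_sorted_le g_neq0 s_path sCB; rewrite size_s -/w => w_last.
rewrite ord_succ_le; apply: le_lt_trans w_last _.
suff /sCB/CB_subset : last ord_zero s \in s by [].
by move: size_s m_gt0; case: (s) => [<-//|x s' _ _]; rewrite /= mem_last.
Qed.

(** Were the order type of [Y] below [omega ^ g], [CB_bounded_finite] would leave only finitely many
    points of some rank [d < g] in it, while the collapse preserves ranks. *)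
Lemma order_homeomorphic_omega_exp (g b : Ord) (Y : set Ord) :
  g <> ord_zero -> acc_closed Y -> Y `<=` seg b ->
  (forall d, d < g -> infinite_set (CB Y d)) ->
  exists2 Z : set Ord, Z `<=` Y & order_homeomorphic Z (seg (omega ^ g)%Ord).
Proof.
move=> g0 Ycl Yb Yinf; apply: (collapse_initial_segment Ycl Yb).
have hh := collapse_homeomorphism Ycl Yb.
rewrite leNgt; apply/negP => cg.
have [d dg fin] := CB_bounded_finite (seg (collapse Y b)) cg g0.
have := Yinf d dg; rewrite -[CB Y d]setIT => /(homeomorphism_CB_infinite hh).
move=> inf; apply: (sub_infinite_set _ inf) fin.
by move=> x [Cx _]; split=> //; exact/ltW/(CB_subset Cx).
Qed.

(** * The non-compact case *)

Section Noncompact.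
Variables (g : Ord).
Hypothesis g_neq0 : g <> ord_zero.
Local Notation a := (omega ^ g)%Ord.

Variables (X : set Ord) (f k : Ord -> Ord) (b : Ord).
Hypotheses (Xb : X `<=` seg b) (fX : forall x, X x -> f x < a)
  (kX : forall z, z < a -> X (k z)) (fK : forall x, X x -> k (f x) = x)
  (kK : forall z, z < a -> f (k z) = z)
  (cf : {within X, continuous f}) (ck : {within seg a, continuous k}).

Let hf : homeomorphism X (seg a) f.
Proof.
exists k; split=> //; split=> // x; rewrite inE.
  exact: fK.
exact: kK.
Qed.

Let hk : homeomorphism (seg a) X k.
Proof.
exists f; split=> //; split=> // x; rewrite inE.
  exact: kK.
exact: fK.
Qed.

(** [E] lies in the image under [k] of the compact segment [[0, e]]. *)
Let acc_bounded (E : set Ord) e r : E `<=` X -> e < a ->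
  (forall z, E z -> f z <= e) -> acc E r -> X r.
Proof.
move=> EX ea Ee accE.
suff [z ze <-] : (k @` [set x | x <= e]) r by apply: kX; exact: le_lt_trans ea.
apply: acc_image_segment ck ea _.
apply: acc_sub accE => z Ez; exists (f z); first exact: Ee.
by rewrite fK//; exact: EX.
Qed.

(** By continuity [f] stays at most [f x] on [X] just to the left of [x], so [acc_bounded] applies
    there. *)
Let locally_closed x : X x -> x <> ord_zero -> exists2 q, q < x &
  forall r, acc (X `&` [set z | q < z /\ z <= x]) r -> X r.
Proof.
move=> Xx x0.
suff [q qx qf] : exists2 q, q < x & forall z, q < z -> z <= x -> X z -> f z <= f x.
  exists q => // r; apply: (@acc_bounded _ (f x)); first by move=> z [].
    exact: fX.
  by move=> z [Xz [qz zx]]; exact: qf.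
have : nbhs (f x) [set z | z <= f x] by apply/ord_nbhsP; left.
move/subspace_continuousP: cf => /(_ x Xx) /[apply] /ord_nbhsP[h|[q qx h]].
  by exists ord_zero; [exact: ord_gt0|move=> z _; exact: h].
by exists q.
Qed.

Let big (p : Ord) := forall d, d < g -> infinite_set (CB X d `&` seg p).

Let big_min : exists2 p, big p & forall q, q < p -> ~ big q.
Proof.
have big_b : big b.
  move=> d dg; have := CB_omega_exp_infinite dg; rewrite -[CB _ _]setIT.
  move=> /(homeomorphism_CB_infinite hk); apply: sub_infinite_set.
  by move=> x [Xx _]; split=> //; exact: Xb (CB_subset Xx).
have [p bp pmin] := ord_minP (ex_intro big b big_b).
by exists p => // q qp /pmin; rewrite leNgt qp.
Qed.

(** As [q] is not big, some rank [e] occurs finitely often below [q]; points of rank [max d e] must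
    then abound above [q]. *)
Let big_tail p q d : big p -> ~ big q -> d < g ->
  infinite_set (CB X d `&` [set z | q < z /\ z < p]).
Proof.
move=> bp /existsNP[e /not_implyP[eg /contrapT fin_e]] dg.
have fg : Order.max d e < g by rewrite gt_max dg.
have fin : finite_set (CB X (Order.max d e) `&` seg q `|` [set q]).
  rewrite finite_setU; split; last exact: finite_set1.
  apply: sub_finite_set fin_e => z [Xz zq]; split=> //.
  by apply: CB_le Xz; rewrite le_max lexx orbT.
apply: sub_infinite_set (infinite_setD (bp _ fg) fin) => z [[Xz zp] nz].
split; first by apply: CB_le Xz; rewrite le_max lexx.
split=> //; rewrite ltNge le_eqVlt; apply/negP => /predU1P[zq|zq].
  by apply: nz; right.
by apply: nz; left.
Qed.

Let embeds := exists2 Z : set Ord, Z `<=` X &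
  order_homeomorphic Z (seg a).

Let embeds_countable (s : nat -> Ord) : (forall n, s n < g) ->
  (forall d, d < g -> exists n, d <= s n) -> embeds.
Proof.
move=> sg s_cof.
(* Running maxima: once a rank [d] is reached, all later terms are at least [d]. *)
pose t := fix t n := if n is n'.+1 then Order.max (t n') (s n) else s 0%N.
have tg n : t n < g by elim: n => //= n IH; rewrite gt_max IH sg.
have st n : s n <= t n by case: n => //= n; rewrite le_max lexx orbT.
have t_mono : {homo t : m n / (m <= n)%N >-> m <= n}.
  apply: homo_leq => //; first exact: le_trans.
  by move=> n; rewrite /= le_max lexx.
have [p bp pmin] := big_min.
have p0 : ord_zero < p.
  apply: ord_gt0 => p0; have /infinite_setN0[z [_]] := bp _ (ord_gt0 g_neq0).
  by rewrite p0 /seg /= ltNge ord_ge0.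
have /choice[D DP] (qn : Ord * nat) : exists z, qn.1 < p ->
    [/\ CB X (t qn.2) z, qn.1 < z & z < p].
  have [qp|_] := ltP qn.1 p; last by exists b.
  have /infinite_setN0[z [Xz [qz zp]]] := big_tail bp (pmin _ qp) (tg qn.2).
  by exists z.
have /choice[Q QP] x : exists q, X x -> x <> ord_zero -> q < x /\
    forall r, acc (X `&` [set z | q < z /\ z <= x]) r -> X r.
  have [[Xx x0]|h] := pselect (X x /\ x <> ord_zero).
    by have [q qx qr] := locally_closed Xx x0; exists q.
  by exists b => Xx x0; case: h.
pose u := fix u n := if n is n'.+1 then D (u n', n') else ord_zero.
have up n : u n < p by elim: n => //= n /(DP (_, n))[].
have u_incr n : u n < u n.+1 by have [] := DP (_, n) (up n).
have uCB n : CB X (t n) (u n.+1) by have [] := DP (_, n) (up n).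
have u_mono := incr_seq_lt u_incr.
have u_lt m n : u m < u n -> (m < n)%N.
  move=> mn; have [//|/u_mono nm|E] := ltngtP m n.
    by have := lt_trans mn nm; rewrite ltxx.
  by move: mn; rewrite E ltxx.
have u_neq0 n : u n.+1 <> ord_zero.
  by move=> E; move: (u_incr n); rewrite E ltNge ord_ge0.
have uQ n : Q (u n.+1) < u n.+1.
  by have [] := QP _ (CB_subset (uCB n)) (u_neq0 n).
(* The bound [u n] makes the pieces disjoint; the bound [Q] puts the limit points of each piece of
   [X] into [X]. *)
pose I n : set Ord := [set z | [/\ u n < z, Q (u n.+1) < z & z <= u n.+1]].
pose Y : set Ord := [set z | exists n, X z /\ I n z].
have YX : Y `<=` X by move=> z [n []].
have Ycl : acc_closed Y.
  move=> r y [r0 hr] [n [Xy [uy _ yu]]] ry.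
  have : exists n, r <= u n by exists n.+1; apply: le_trans (ltW ry) yu.
  (* With [u j < r <= u j.+1], only the piece [I j] can accumulate at [r]. *)
  move=> /ex_minnP[[|j] rj jmin].
    by move: rj r0 => + /ord_gt0; rewrite leNgt => /negP.
  have ur : u j < r by rewrite ltNge; apply/negP => /jmin; rewrite ltnn.
  have accI : acc (X `&` I j) r.
    split=> // q qr; have [|z [[i [Xz [uz Qz zu]]] + zr]] := hr (Order.max q (u j)).
      by rewrite gt_max qr.
    rewrite gt_max => /andP[qz ujz]; exists z; split=> //; split=> //.
    suff -> : j = i by [].
    have ij : (i < j.+1)%N by apply: u_lt; apply: lt_trans uz _;
      exact: lt_le_trans zr rj.
    have ji : (j < i.+1)%N by apply: u_lt; exact: lt_le_trans ujz zu.
    by apply: anti_leq; rewrite -ltnS ji -ltnS ij.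
  have [Qr Xr] := QP _ (CB_subset (uCB j)) (u_neq0 j).
  have XIr : acc (X `&` [set z | Q (u j.+1) < z /\ z <= u j.+1]) r.
    by apply: acc_sub accI => z [Xz [_ Qz zu]].
  have {}Xr := Xr _ XIr; exists j; split=> //; split=> //.
  have [_ accQ] := accI; have [z [[_ [_ Qz _]] _ zr]] := accQ _ ur.
  exact: lt_trans zr.
have Yb : Y `<=` seg b by move=> z /YX/Xb.
have [|Z ZY oZ] := order_homeomorphic_omega_exp g_neq0 Ycl Yb; last first.
  by exists Z => // z /ZY/YX.
move=> d /s_cof[n dn].
have inf : infinite_set (range (fun i => u (n + i).+1)).
  by apply: infinite_range_incr => i; apply: u_mono; rewrite addnS.
apply: sub_infinite_set inf => _ [i _ <-].
have dti : d <= t (n + i)%N.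
  by apply: le_trans (le_trans dn (st n)) _; apply: t_mono; exact: leq_addr.
apply: (CB_le dti); apply: (@CB_local X Y (I (n + i)%N)).
- move=> x [ux Qx xu] _; exists (Order.max (u (n + i)%N) (Q (u (n + i).+1))).
    by rewrite gt_max ux.
  move=> z; rewrite gt_max => /andP[uz Qz] zx; split=> //.
  exact/ltW/(lt_le_trans zx).
- by move=> z [Xz Iz]; exists (n + i)%N.
- by split; [exact: uCB|split].
Qed.

(** Each [v n] is below some [omega ^ s * m] with [s < g]; a strict bound [d] on these exponents
    gives the bound [omega ^ d]. *)
Let omega_exp_seq_bounded :
  (forall s : nat -> Ord, (forall n, s n < g) ->
     exists2 d, d < g & forall n, s n < d) ->
  forall v : nat -> Ord, (forall n, v n < a) ->
    exists2 w, w < a & forall n, v n < w.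
Proof.
move=> g_cof v va.
have /choice[s sP] n : exists s, s < g /\ exists m, v n < (omega ^ s * m%:O)%Ord.
  by have [s [m [sg vm]]] := iffLR (omega_exp_ltP _ g_neq0) (va n);
    exists s; split=> //; exists m.
have [|d dg sd] := g_cof s; first by move=> n; have [] := sP n.
exists (omega ^ d)%Ord.
  by have := omega_exp_mul_lt 1 dg; rewrite ord_mul1.
move=> n; have [_ [m vm]] := sP n; apply: lt_trans vm _.
exact: omega_exp_mul_lt.
Qed.

(* Closed unbounded subsets of [a] meet when [a] has uncountable cofinality,  *)
(* so [X] cannot miss a limit point [r] below [p].                            *)
Let embeds_uncountable :
  (forall s : nat -> Ord, (forall n, s n < g) ->
     exists2 d, d < g & forall n, s n < d) -> embeds.
Proof.
move=> /omega_exp_seq_bounded bounded.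
have [p bp pmin] := big_min.
suff [Z ZY oZ] : exists2 Z : set Ord, Z `<=` X `&` seg p &
    order_homeomorphic Z (seg a).
  by exists Z => // z /ZY[].
apply: (@order_homeomorphic_omega_exp _ b) => //; last first.
- move=> d dg; apply: sub_infinite_set (bp d dg); apply: CB_local => // x xp x0.
  by exists ord_zero; [exact: ord_gt0|move=> z _ zx; exact: lt_trans xp].
- by move=> z [/Xb].
move=> r y accr [Xy yp] ry; have rp : r < p by exact: lt_trans yp.
split=> //; apply: contrapT => nXr.
(* Otherwise [f] is bounded on the part of [X] below [r], and compactness puts [r] in [X]. *)
have low e : e < a -> exists z, [/\ X z, z < r & e < f z].
  move=> ea; apply: contrapT => h; apply: nXr.
  apply: (@acc_bounded (X `&` seg r) e) => //.
    move=> z [Xz zr]; rewrite leNgt; apply/negP => ez; apply: h; by exists z.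
  have [r0 hr] := accr; split=> // q /hr[z [[Xz _] qz zr]].
  by exists z; split.
(* By minimality of [p], [r] is not big, so each rank below [g] occurs infinitely often between [r]
   and [p]; for some rank only finitely many images are at most [e]. *)
have high e : e < a -> exists z, [/\ X z, r < z & e < f z].
  move=> ea; apply: contrapT => h.
  have [d dg fin] := CB_bounded_finite (seg a) ea g_neq0.
  have inf := homeomorphism_CB_infinite hf (big_tail bp (pmin _ rp) dg).
  apply: (sub_infinite_set _ inf) fin => x [Cx [z [/CB_subset Xz [rz _]] zx]].
  split=> //; rewrite /= leNgt; apply/negP => ex; apply: h; exists z.
  by rewrite zx.
have /choice[N NP] e : exists zz : Ord * Ord, e < a ->
    [/\ X zz.1, zz.1 < r & e < f zz.1] /\
    [/\ X zz.2, r < zz.2 & f zz.1 < f zz.2].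
  have [ea|_] := ltP e a; last by exists (e, e).
  have [z1 [Xz1 z1r ez1]] := low _ ea.
  by have [z2 [Xz2 rz2 z12]] := high _ (fX Xz1); exists (z1, z2).
(* Images of points below and above [r] alternate and increase, so both kinds have the same supremum
   [s]. *)
pose v := fix v n := if n is n'.+1 then f (N (v n')).2 else ord_zero.
have va n : v n < a.
  elim: n => [|n IH /=]; first exact: omega_exp_gt0.
  by have [_ [Xz _ _]] := NP _ IH; exact: fX.
have [w wa vw] := bounded v va.
have [s vs smin] := ord_minP (ex_intro (fun s => forall n, v n < s) w vw).
have sa : s < a by exact: le_lt_trans (smin w vw) wa.
have s0 : s <> ord_zero by move=> E; have := vs 0%N; rewrite E ltxx.
have vq q : q < s -> exists n, q <= v n.
  move=> qs; apply: contrapT => h; move: qs; rewrite ltNge => /negP; apply.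
  apply: smin => n; rewrite ltNge; apply/negP => qv; apply: h; by exists n.
have vS n : v n < f (N (v n)).1 /\ f (N (v n)).1 < v n.+1.
  by have [[_ _ ?] [_ _ ?]] := NP _ (va n).
have acc_k (E : set Ord) : E `<=` X -> acc (f @` E) s -> acc E (k s).
  move=> EX accs.
  have kinj : {in seg a &, injective k}.
    by apply: (@can_in_inj _ _ _ _ f) => z; rewrite inE; exact: kK.
  apply: acc_sub (within_continuous_acc ck kinj _ sa accs).
    by move=> _ [_ [z Ez <-] <-]; rewrite fK//; exact: EX.
  by move=> _ [z Ez <-]; exact/fX/EX.
have [_ acc1] : acc (X `&` [set z | z < r]) (k s).
  apply: acc_k; first by move=> z [].
  split=> // q /vq[n qv]; have [vN Nv] := vS n; have [[X1 r1 _] _] := NP _ (va n).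
  exists (f (N (v n)).1); split; first by exists (N (v n)).1.
    exact: le_lt_trans vN.
  exact: lt_trans (vs n.+1).
have [ks0 acc2] : acc (X `&` [set z | r < z]) (k s).
  apply: acc_k; first by move=> z [].
  split=> // q /vq[n qv]; have [vN Nv] := vS n; have [_ [X2 r2 _]] := NP _ (va n).
  exists (f (N (v n)).2); split; first by exists (N (v n)).2.
    exact: le_lt_trans (lt_trans vN Nv).
  exact: vs n.+1.
have [z [[_ rz] _ zks]] := acc2 _ (ord_gt0 ks0).
have [z' [[_ z'r] zz' _]] := acc1 _ zks.
by have := lt_trans z'r (lt_trans rz zz'); rewrite ltxx.
Qed.

Lemma embeds_omega_exp : exists2 Z : set Ord, Z `<=` X &
  order_homeomorphic Z (seg a).
Proof.
(* A successor [g] falls under the first case, through a constant sequence. *)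
have [[s [sg s_cof]]|h] := pselect (exists s : nat -> Ord,
    (forall n, s n < g) /\ (forall d, d < g -> exists n, d <= s n)).
  exact: embeds_countable s_cof.
apply: embeds_uncountable => s sg; apply: contrapT => nex; apply: h.
exists s; split=> // d dg; apply: contrapT => h; apply: nex; exists d => // n.
by rewrite ltNge; apply/negP => dn; apply: h; exists n.
Qed.

End Noncompact.

Lemma order_reinforcing_omega_exp (g : Ord) :
  g <> ord_zero -> order_reinforcing (omega ^ g)%Ord.
Proof.
move=> g0 X [b Xb] [f [k [[fX kX fK kK] [cf ck]]]].
apply: (embeds_omega_exp g0 Xb fX kX _ _ cf ck) => x xX.
  by rewrite fK// inE.
by rewrite kK// inE.
Qed.

Theorem theorem2p17 (gamma : Ord) (m : nat)
    (gamma_neq0 : gamma <> ord_zero) (m_gt0 : (0 < m)%N) :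
  order_reinforcing (omega ^ gamma * m%:O + 1%:O)%Ord /\
  order_reinforcing (omega ^ gamma)%Ord.
Proof.
split; first exact: order_reinforcing_omega_exp_mul_succ.
exact: order_reinforcing_omega_exp.
Qed.
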